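(* Let $I\subset\mathbb{R}$ be a bounded interval, let $m,n,k\ge1$, and let $\beta,\gamma\in(0,1]$ with $\beta(1+\gamma)>1$. Let $g\in C^{\beta}(I^m;\mathbb{R}^k)$ and define $$h\colon I^{m+n}\to\mathbb{R}^{k+n},\qquad h_x:=(g_{x^m},x^n)\quad\text{for } x=(x^m,x^n)\in I^m\times I^n=I^{m+n}.$$ Let $f\colon I^{m+n}\to\mathbb{R}^n$ be $h$-differentiable with $\mathbb{D}_h f=(\mathbb{D}_g f,\mathbb{D}_{x^n}f)\in C^{\gamma}(I^{m+n};\mathbb{R}^{n\times(k+n)})$, and let $x_0$ be an interior point of $I^{m+n}$ which is non-degenerate, i.e. the $n\times n$ matrix $(\mathbb{D}_{x^n}f)_{x_0}$ is invertible. Then there exist open sets $J^m\subseteq I^m$ and $J^n\subseteq I^n$ with $x_0\in J^m\times J^n\subseteq I^{m+n}$ and a unique $\theta\colon J^m\to I^n$ such that $$f^{-1}(f_{x_0})\cap (J^m\times J^n)=\bar\theta(J^m),\qquad\text{where }\bar\theta_p:=(p,\theta_p).$$ Moreover, $\theta$ is $g$-differentiable, with $$\mathbb{D}_g\theta=-(\mathbb{D}_{x^n}f)_{\bar\theta}^{-1}(\mathbb{D}_g f)_{\bar\theta}\in C^{\beta\gamma}(J^m;\mathbb{R}^{n\times k}).$$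
   Context: Notation: for a function $u$ and points $p,q$ of its domain, $u_p:=u(p)$, $\delta u_{pq}:=u_q-u_p$, $\delta_{pq}:=q-p$; $u_{\bar\theta}:=u\circ\bar\theta$. $C^{\alpha}(X;\mathbb{R}^N)$, $\alpha\in(0,1]$, is the space of $u\colon X\to\mathbb{R}^N$ with $\sup_X|u|+\sup_{x\ne y}|u_y-u_x|/|y-x|^{\alpha}<\infty$. A function $R$ of pairs $(p,q)$ is $o(\delta_{pq})$ if it vanishes for $p=q$ and $\sup_{0<|q-p|\le\varepsilon}|R_{pq}|/|q-p|\to0$ as $\varepsilon\to0$. Differentiability with respect to a map: for $G\colon X\to\mathbb{R}^K$ continuous, $X\subseteq\mathbb{R}^N$, a map $u\colon X\to\mathbb{R}^M$ is $G$-differentiable if there is a continuous $\mathbb{D}_G u=(\partial_{G^i}u^j)\colon X\to\mathbb{R}^{M\times K}$ (a $G$-derivative, not necessarily unique; the formula for $\mathbb{D}_g\theta$ asserts that its right-hand side is a $g$-derivative of $\theta$) with $\delta u_{xy}=(\mathbb{D}_G u)_x\,\delta G_{xy}+o(\delta_{xy})$ for $x,y\in X$. $\mathbb{D}_g f$ and $\mathbb{D}_{x^n}f$ denote the blocks of $\mathbb{D}_h f$ corresponding to the components $g_{x^m}$ and $x^n$ of $h$. *)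

(* Defs.v *)
From HB Require Import structures.
From mathcomp Require Export all_boot all_order all_algebra.
From mathcomp Require Export all_classical all_reals all_analysis.
Export Order.TTheory GRing.Theory Num.Theory.
Export numFieldNormedType.Exports.

#[export] Set Implicit Arguments.
#[export] Unset Strict Implicit.
#[export] Unset Printing Implicit Defensive.

Local Open Scope classical_set_scope.
Local Open Scope ring_scope.

(* Vectors are columns and `|.| is the library's (max) norm on matrices.      *)
(* A map defined on a subset X of R^N is represented by a total function, and *)
(* every notion below only constrains its values on X.                        *)

Definition cube {R : realType} (I : set R) (N : nat) : set 'cV[R]_N :=
  [set x | forall i, I (x i 0)].
Arguments cube {R} I N _.

(* A x B, as a subset of R^(m+n) *)
Definition prod_set {R : realType} (m n : nat)
    (A : set 'cV[R]_m) (B : set 'cV[R]_n) : set 'cV[R]_(m + n) :=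
  [set x | A (usubmx x) /\ B (dsubmx x)].

(* u \in C^alpha(X; V) *)
Definition holder {R : realType} {N : nat} {V : normedModType R}
    (alpha : R) (X : set 'cV[R]_N) (u : 'cV[R]_N -> V) : Prop :=
  [bounded u x | x in X] /\
  exists L : R, forall x y, X x -> X y ->
    `|u y - u x| <= L * (`|y - x| `^ alpha).

(* r p q = o(q - p), uniformly over p, q in X *)
Definition unif_little_o {R : realType} {N : nat} {V : normedModType R}
    (X : set 'cV[R]_N) (r : 'cV[R]_N -> 'cV[R]_N -> V) : Prop :=
  (forall p, X p -> r p p = 0) /\
  forall e : R, 0 < e -> \forall d \near 0^'+,
    forall p q, X p -> X q -> 0 < `|q - p| <= d ->
      `|r p q| / `|q - p| <= e.

(* D is a G-derivative of u on X; G is meant to be continuous on X. *)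
Definition is_derivative_wrt {R : realType} {N K M : nat} (X : set 'cV[R]_N)
    (G : 'cV[R]_N -> 'cV[R]_K) (u : 'cV[R]_N -> 'cV[R]_M)
    (D : 'cV[R]_N -> 'M[R]_(M, K)) : Prop :=
  {within X, continuous D} /\
  unif_little_o X (fun x y => (u y - u x) - D x *m (G y - G x)).

(* h_x = (g_{x^m}, x^n) *)
Definition adjoin_id {R : realType} {m k n : nat} (g : 'cV[R]_m -> 'cV[R]_k)
    (x : 'cV[R]_(m + n)) : 'cV[R]_(k + n) :=
  col_mx (g (usubmx x)) (dsubmx x).

(* p |-> (p, theta_p) *)
Definition graph_map {R : realType} {m n : nat} (theta : 'cV[R]_m -> 'cV[R]_n)
    (p : 'cV[R]_m) : 'cV[R]_(m + n) :=
  col_mx p (theta p).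

(* theta : Jm -> I^n parametrizes, as a graph, the part of the level set of f *)
(* through x0 which lies in Jm x Jn                                           *)
Definition parametrizes {R : realType} {m n : nat} (I : set R)
    (f : 'cV[R]_(m + n) -> 'cV[R]_n) (x0 : 'cV[R]_(m + n))
    (Jm : set 'cV[R]_m) (Jn : set 'cV[R]_n) (theta : 'cV[R]_m -> 'cV[R]_n) :
    Prop :=
  (forall p, Jm p -> cube I n (theta p)) /\
  f @^-1` [set f x0] `&` prod_set Jm Jn = graph_map theta @` Jm.

(* Main.v *)
From HB Require Import structures.
From mathcomp Require Import ring lra.
Require Import Defs.

Local Open Scope classical_set_scope.
Local Open Scope ring_scope.

(** Write a point as (p, a) with p in I^m and a in I^n, and let A and P be the
    blocks of Df that multiply the increments of a and of g.  For fixed p the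
    o(.) expansion of f is an ordinary first-order expansion in a, whose
    differential A(p, .) is Hölder continuous; hence, with B the inverse of
    A(x0), near x0 the increments of a |-> B f(p, a) are close to those of a, uniformly
    in p ([vertical_inverse_near]).  Newton's iteration
    a |-> a - B (f(p, a) - f(x0)) is then a contraction of a small ball, whose
    fixed point is theta(p) ([newton_zero]).  Since f(., a) is beta-Hölder
    ([horizontal_holder]), so is theta.

    The point that is not classical is the differentiability of theta.  The
    graph of theta is only beta-Hölder, so the remainder of f between two of
    its points is a priori o(|q - p|^beta), which is too weak.  The remedy is
    to join (p, a) = (p, theta p) to (q, b) = (q, theta q) through the corner
    (q, a).
    The horizontal part has a remainder o(|q - p|), because only p moves.  The
    vertical part has a remainder O(|b - a|^(1 + gamma)), which is better than
    the defining o(.) and comes from the Hölder continuity of A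
    ([holder_remainder], [vertical_remainder]).  Moving A from (q, a) back to
    (p, a) costs O(|q - p|^gamma |b - a|).  With |b - a| = O(|q - p|^beta) and
    |q - p| <= 1, the last two errors are O(|q - p|^(beta (1 + gamma))), and
    this is o(|q - p|) precisely because beta (1 + gamma) > 1
    ([implicit_remainder]).  The Hölder exponent of the derivative is
    beta * gamma because it is a smooth function of Df, which is gamma-Hölder,
    evaluated along the beta-Hölder graph ([holder_comp],
    [holder_invmx_mulmx]). *)

(** * The max norm of matrices and of their blocks *)

Lemma mx_norm_leP {R : realType} {m n : nat} (A : 'M[R]_(m, n)) (c : R) :
  0 <= c -> (forall i j, `|A i j| <= c) <-> `|A| <= c.
Proof.
move=> c0; rewrite [`|A|]mx_normrE; split.
  by move=> Ac; apply/bigmax_leP; split => // -[i j] _ /=.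
by move=> /bigmax_leP[_ Ac] i j; exact: (Ac (i, j)).
Qed.

Lemma ler_norm_entry {R : realType} {m n : nat} (A : 'M[R]_(m, n)) i j :
  `|A i j| <= `|A|.
Proof. exact: (mx_norm_leP A (normr_ge0 A)).2. Qed.

(** The factor p is the price of the max norm, which is not submultiplicative. *)
Lemma ler_norm_mulmx {R : realType} {m p n : nat} (A : 'M[R]_(m, p))
    (B : 'M[R]_(p, n)) : `|A *m B| <= p%:R * (`|A| * `|B|).
Proof.
apply/mx_norm_leP => [|i j]; first by rewrite !mulr_ge0.
rewrite mxE (le_trans (ler_norm_sum _ _ _))//.
rewrite (@le_trans _ _ (\sum_(l < p) `|A| * `|B|))//.
  by apply: ler_sum => l _; rewrite normrM ler_pM// ler_norm_entry.
by rewrite sumr_const card_ord mulr_natl.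
Qed.

Lemma ler_norm_usubmx {R : realType} {m1 m2 n : nat} (A : 'M[R]_(m1 + m2, n)) :
  `|usubmx A| <= `|A|.
Proof. by apply/mx_norm_leP => // i j; rewrite mxE ler_norm_entry. Qed.

Lemma ler_norm_dsubmx {R : realType} {m1 m2 n : nat} (A : 'M[R]_(m1 + m2, n)) :
  `|dsubmx A| <= `|A|.
Proof. by apply/mx_norm_leP => // i j; rewrite mxE ler_norm_entry. Qed.

Lemma ler_norm_lsubmx {R : realType} {m n1 n2 : nat} (A : 'M[R]_(m, n1 + n2)) :
  `|lsubmx A| <= `|A|.
Proof. by apply/mx_norm_leP => // i j; rewrite mxE ler_norm_entry. Qed.

Lemma ler_norm_rsubmx {R : realType} {m n1 n2 : nat} (A : 'M[R]_(m, n1 + n2)) :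
  `|rsubmx A| <= `|A|.
Proof. by apply/mx_norm_leP => // i j; rewrite mxE ler_norm_entry. Qed.

Lemma norm_col_mx {R : realType} {m1 m2 n : nat} (A : 'M[R]_(m1, n))
    (B : 'M[R]_(m2, n)) : `|col_mx A B| = Num.max `|A| `|B|.
Proof.
apply/eqP; rewrite eq_le ge_max; apply/and3P; split.
- apply/mx_norm_leP => [|i j]; first by rewrite le_max normr_ge0.
  rewrite mxE; case: (fintype.split i) => l;
    by rewrite le_max ler_norm_entry ?orbT.
- by rewrite -[in leLHS](col_mxKu A B) ler_norm_usubmx.
- by rewrite -[in leLHS](col_mxKd A B) ler_norm_dsubmx.
Qed.

Lemma norm_col_mx0r {R : realType} {m1 m2 n : nat} (A : 'M[R]_(m1, n)) :
  `|col_mx A (0 : 'M[R]_(m2, n))| = `|A|.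
Proof. by rewrite norm_col_mx normr0 max_l. Qed.

Lemma norm_col_mx0l {R : realType} {m1 m2 n : nat} (B : 'M[R]_(m2, n)) :
  `|col_mx (0 : 'M[R]_(m1, n)) B| = `|B|.
Proof. by rewrite norm_col_mx normr0 max_r. Qed.

(** * Uniform remainders and first-order expansions *)

Lemma unif_little_oP {R : realType} {N : nat} {V : normedModType R}
    (X : set 'cV[R]_N) (r : 'cV[R]_N -> 'cV[R]_N -> V) :
  unif_little_o X r <-> forall e : R, 0 < e -> exists2 d : R, 0 < d &
    forall p q, X p -> X q -> `|q - p| <= d -> `|r p q| <= e * `|q - p|.
Proof.
split=> [[r0 ro] e e0|ro].
  have [d /= d0 dP] := ro e e0.
  exists (d / 2); first lra.
  move=> p q Xp Xq pqd.
  have [<-|npq] := eqVneq p q; first by rewrite r0// subrr !normr0 mulr0.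
  have pq0 : 0 < `|q - p| by rewrite normr_gt0 subr_eq0 eq_sym.
  rewrite -ler_pdivrMr//; apply: (dP (d / 2)) => //=; last 2 first.
  - lra.
  - by rewrite pq0.
  - rewrite sub0r normrN gtr0_norm; lra.
split.
  move=> p Xp; have [d d0] := ro 1 ltr01.
  move=> /(_ p p Xp Xp); rewrite subrr normr0 mulr0 => /(_ (ltW d0)).
  by rewrite normr_le0 => /eqP.
move=> e e0; have [d d0 dP] := ro e e0.
exists d => //= d' /=; rewrite sub0r normrN => d'd d'0 p q Xp Xq /andP[pq0 pqd'].
rewrite ler_pdivrMr// dP// (le_trans pqd')// ltW// (le_lt_trans _ d'd)//.
exact: ler_norm.
Qed.

Lemma powR_near0 {R : realType} (C al e : R) : 0 < al -> 0 < e ->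
  exists2 d : R, 0 < d & forall t, 0 <= t <= d -> C * t `^ al <= e.
Proof.
move=> al0 e0.
have C0 : 0 < `|C| + 1 by rewrite ltr_wpDl.
have eC0 : 0 < e / (`|C| + 1) by rewrite divr_gt0.
exists ((e / (`|C| + 1)) `^ al^-1) => [|t /andP[t0 td]]; first exact: powR_gt0.
have tal : t `^ al <= e / (`|C| + 1).
  rewrite (le_trans (ge0_ler_powR (ltW al0) _ _ td)) ?nnegrE// ?powR_ge0//.
  by rewrite -powRrM mulVf ?gt_eqF// powRr1 ?(ltW eC0).
rewrite (@le_trans _ _ ((`|C| + 1) * t `^ al))//.
  by rewrite ler_wpM2r ?powR_ge0// (le_trans (ler_norm C))// lerDl.
by rewrite mulrC -ler_pdivlMr.
Qed.

(** A first-order expansion whose differential is al-Hölder has a remainder of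
    order 1 + al, without any mean value theorem: cut the segment [x, y] into K
    equal pieces.  Along the pieces the o(.) remainders add up to at most
    e |y - x|, for any e > 0 once K is large, and replacing the differential at
    the subdivision points by the one at x costs |y - x|^al on each piece. *)
Lemma holder_remainder {R : realType} {M N : nat} (S : set 'cV[R]_N)
    (F : 'cV[R]_N -> 'cV[R]_M) (DF : 'cV[R]_N -> 'M[R]_(M, N)) (L al : R) :
  0 <= L -> 0 < al ->
  (forall x y t, S x -> S y -> 0 <= t <= 1 -> S (x + t *: (y - x))) ->
  (forall x y, S x -> S y -> `|DF y - DF x| <= L * `|y - x| `^ al) ->
  unif_little_o S (fun x y => F y - F x - DF x *m (y - x)) ->
  forall x y, S x -> S y ->
    `|F y - F x - DF x *m (y - x)| <= N%:R * L * (`|y - x| `^ al * `|y - x|).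
Proof.
move=> L0 al0 convS DFL /unif_little_oP Fo x y Sx Sy.
set t := `|y - x|; have t0 : 0 <= t by exact: normr_ge0.
apply/ler_addgt0Pr => e e0.
have t1 : 0 < t + 1 by lra.
have [d d0 dP] := Fo _ (divr_gt0 e0 t1).
(* K is so large that each of the K pieces has length at most d. *)
pose K := (Num.bound (t / d)).+1.
have K0 : 0 < K%:R :> R by rewrite ltr0n.
have tK : t / K%:R <= d.
  rewrite ler_pdivrMr// mulrC -ler_pdivrMr// ltW//.
  rewrite (lt_le_trans (archi_boundP _)) ?divr_ge0 ?(ltW d0)//.
  by rewrite ler_nat.
pose c (i : nat) := x + (i%:R / K%:R) *: (y - x).
have frac i : (i <= K)%N -> 0 <= (i%:R / K%:R : R) <= 1.
  by move=> iK; rewrite divr_ge0//= ler_pdivrMr// mul1r ler_nat.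
have Sc i : (i <= K)%N -> S (c i) by move=> iK; apply: convS => //; exact: frac.
have cS i : c i.+1 - c i = K%:R^-1 *: (y - x).
  rewrite /c opprD addrACA subrr add0r -scalerBl -mulrBl.
  by rewrite -natrB// subSn// subnn mul1r.
have main i : (i <= K)%N ->
    `|F (c i) - F x - DF x *m (c i - x)| <=
    i%:R * ((N%:R * (L * t `^ al) + e / (t + 1)) * (t / K%:R)).
  elim: i => [_|i IH iK].
    by rewrite /c mul0r scale0r addr0 !subrr mulmx0 subrr normr0 mul0r.
  have ciS : `|c i.+1 - c i| = t / K%:R.
    by rewrite cS normrZ gtr0_norm ?invr_gt0// mulrC.
  have -> : F (c i.+1) - F x - DF x *m (c i.+1 - x) =
      (F (c i) - F x - DF x *m (c i - x)) +
      ((F (c i.+1) - F (c i) - DF (c i) *m (c i.+1 - c i)) +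
       (DF (c i) - DF x) *m (c i.+1 - c i)).
    rewrite mulmxBl -[c i.+1 - x](subrKA (c i)) mulmxDr.
    set u := DF x *m _; set v := DF (c i) *m _; set w := DF x *m _.
    set a := F (c i.+1); set b := F (c i); set z := F x.
    by apply/matrixP => k l; rewrite !mxE; ring.
  rewrite -natr1 mulrDl mul1r (le_trans (ler_normD _ _))// lerD ?IH//.
    exact: ltnW.
  rewrite (le_trans (ler_normD _ _))// mulrDl addrC lerD//; last first.
    by rewrite -ciS; apply: dP; rewrite ?ciS//; apply: Sc; rewrite ?(ltnW iK).
  rewrite (le_trans (ler_norm_mulmx _ _))// ciS -mulrA ler_wpM2l//.
  rewrite ler_wpM2r ?divr_ge0//.
  rewrite (le_trans (DFL _ _ Sx (Sc _ (ltnW iK))))// ler_wpM2l//.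
  apply: ge0_ler_powR; rewrite ?nnegrE// ?(ltW al0)//.
  rewrite /c addrC addKr normrZ.
  have /andP[f0 f1] := frac i (ltnW iK).
  by rewrite ger0_norm// ler_piMl.
have cK : c K = y by rewrite /c divff ?gt_eqF// scale1r addrC subrK.
have := main K (leqnn K); rewrite cK => /le_trans; apply.
rewrite (_ : _ * _ = N%:R * L * (t `^ al * t) + e * (t / (t + 1))); last first.
  by field; rewrite !gt_eqF.
rewrite lerD2l ler_piMr ?(ltW e0)// ler_pdivrMr//; lra.
Qed.

(** * Solving an equation by Newton's iteration *)

(** Matrices over R are complete and normed; this declares the join of the two
    structures, which the fixed point theorem requires. *)
HB.instance Definition _ (R : realType) (m n : nat) :=
  Complete.copy 'M[R]_(m, n) 'M[R]_(m, n).

(** Newton's iteration with the frozen inverse B: the hypothesis on B F makes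
    Phi contract by 1/2, and the smallness of B (F a0 - c) makes Phi map the
    closed ball of radius s into itself. *)
Lemma newton_zero {R : realType} {n : nat} (F : 'cV[R]_n -> 'cV[R]_n)
    (B : 'M[R]_n) (a0 c : 'cV[R]_n) (s : R) :
  0 < s ->
  (forall a b, `|a - a0| <= s -> `|b - a0| <= s ->
     `|B *m (F b - F a) - (b - a)| <= 2^-1 * `|b - a|) ->
  `|B *m (F a0 - c)| <= s / 2 ->
  exists2 a, `|a - a0| <= s & B *m (F a - c) = 0.
Proof.
move=> s0 FB F0.
pose U : set 'cV[R]_n := closed_ball a0 s.
have UE a : U a <-> `|a - a0| <= s.
  by rewrite /U closed_ballE// /closed_ball_ /= distrC.
pose Phi a := a - B *m (F a - c).
have PhiB a b : Phi b - Phi a = - (B *m (F b - F a) - (b - a)).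
  have -> : B *m (F b - F a) = B *m (F b - c) - B *m (F a - c).
    by rewrite -mulmxBr opprB addrA subrK.
  rewrite /Phi; move: (B *m (F b - c)) (B *m (F a - c)) => u v.
  by apply/matrixP => i j; rewrite !mxE; ring.
have PhiL a b : U a -> U b -> `|Phi b - Phi a| <= 2^-1 * `|b - a|.
  by move=> /UE Ua /UE Ub; rewrite PhiB normrN FB.
have Ua0 : U a0 by apply/UE; rewrite subrr normr0 ltW.
have PhiU : {homo Phi : a / U a >-> U a}.
  move=> a Ua; apply/UE; have /UE as_ := Ua.
  have := ler_distD (Phi a0) (Phi a) a0; have := PhiL _ _ Ua0 Ua.
  have : `|Phi a0 - a0| <= s / 2 by rewrite /Phi addrAC subrr add0r normrN.
  lra.
have ctr : is_contraction (mkfun PhiU).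
  have h0 : (0 : R) <= 2^-1 by lra.
  exists (NngNum h0); split => /=; first lra.
  by move=> [a b] [/= Ua Ub]; rewrite PhiL.
have [||a Ua aE] := @banach_fixed_point R 'cV[R]_n U (mkfun PhiU) ctr.
- exact: closed_ball_closed.
- by exists a0.
exists a; first exact/UE.
move: aE; rewrite /= /mkfun /Phi => /eqP.
by rewrite -subr_eq0 opprB addrC subrK => /eqP.
Qed.

(** * Inverting a perturbed matrix *)

Lemma perturbed_left_inverse {R : realType} {n j : nat} (A E : 'M[R]_n)
    (V : 'M[R]_(n, j)) : A \in unitmx ->
  `|invmx A *m (E *m V) - V| <=
    n%:R * (`|invmx A| * (n%:R * (`|E - A| * `|V|))).
Proof.
move=> uA.
rewrite -[X in _ - X](mulKmx uA) -mulmxBr -mulmxBl.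
rewrite (le_trans (ler_norm_mulmx _ _))// ler_wpM2l// ler_wpM2l//.
exact: ler_norm_mulmx.
Qed.

(** The hypothesis bounds V by 2 |B E V|.  With V the cokernel of E this shows
    that E is invertible, and with V the inverse of E it bounds that inverse. *)
Lemma approx_left_inverse_unitmx {R : realType} {n : nat} (B E : 'M[R]_n) :
  (forall V : 'M[R]_n, `|B *m (E *m V) - V| <= 2^-1 * `|V|) ->
  E \in unitmx /\ `|invmx E| <= 2 * `|B|.
Proof.
move=> BE.
have bound (V : 'M[R]_n) : `|V| <= 2 * `|B *m (E *m V)|.
  have := ler_distD (B *m (E *m V)) V 0.
  rewrite !subr0 distrC; have := BE V; lra.
have uE : E \in unitmx.
  rewrite -row_full_unit -cokermx_eq0 -normr_le0.
  by rewrite (le_trans (bound _))// mulmx_coker mulmx0 normr0 mulr0.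
by split => //; rewrite (le_trans (bound _))// mulmxV// mulmx1.
Qed.

(** * Hölder maps *)

Lemma holder_bounds {R : realType} {N : nat} {V : normedModType R} (al : R)
    (X : set 'cV[R]_N) (u : 'cV[R]_N -> V) : holder al X u ->
  exists M L : R, [/\ 0 <= M, 0 <= L, forall x, X x -> `|u x| <= M &
    forall x y, X x -> X y -> `|u y - u x| <= L * `|y - x| `^ al].
Proof.
move=> [/ex_strict_bound_gt0[M M0 XM] [L XL]].
exists M, `|L|; split => //; first exact: ltW.
  by move=> x /XM /ltW.
move=> x y Xx Xy; rewrite (le_trans (XL _ _ Xx Xy))// ler_wpM2r ?powR_ge0//.
exact: ler_norm.
Qed.

Lemma holder_intro {R : realType} {N : nat} {V : normedModType R} (al M L : R)
    (X : set 'cV[R]_N) (u : 'cV[R]_N -> V) :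
  (forall x, X x -> `|u x| <= M) ->
  (forall x y, X x -> X y -> `|u y - u x| <= L * `|y - x| `^ al) ->
  holder al X u.
Proof.
move=> XM XL; split; last by exists L.
exists M; split; first exact: num_real.
by move=> M' MM' x /XM xM /=; rewrite (le_trans xM) ?ltW.
Qed.

Lemma holder_within_continuous {R : realType} {N : nat} {V : normedModType R}
    (al : R) (X : set 'cV[R]_N) (u : 'cV[R]_N -> V) :
  0 < al -> holder al X u -> {within X, continuous u}.
Proof.
move=> al0 /holder_bounds[M [L [_ _ _ XL]]].
apply/subspace_continuousP => x Xx; apply/cvgrPdistC_le => e e0.
have [d d0 dP] := powR_near0 L al0 e0.
have : \forall y \near x, `|x - y| < d.
  by apply/nbhs_normP; exists d.
rewrite near_withinE; apply: filterS => y yd Xy.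
rewrite (le_trans (XL _ _ Xx Xy))// dP// normr_ge0/= distrC ltW//.
Qed.

Lemma holder_comp {R : realType} {N N' : nat} {V : normedModType R}
    (al be C : R) (X : set 'cV[R]_N) (Y : set 'cV[R]_N')
    (v : 'cV[R]_N -> 'cV[R]_N') (u : 'cV[R]_N' -> V) :
  0 <= al -> 0 <= C -> holder al Y u -> (forall x, X x -> Y (v x)) ->
  (forall x y, X x -> X y -> `|v y - v x| <= C * `|y - x| `^ be) ->
  holder (be * al) X (u \o v).
Proof.
move=> al0 C0 /holder_bounds[M [L [M0 L0 uM uL]]] XY vC.
apply: (@holder_intro _ _ _ _ M (L * C `^ al)).
  by move=> x /XY /uM.
move=> x y Xx Xy /=; rewrite (le_trans (uL _ _ (XY _ Xx) (XY _ Xy)))//.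
rewrite -mulrA ler_wpM2l// powRrM -powRM ?powR_ge0//.
by apply: ge0_ler_powR; rewrite ?nnegrE ?mulr_ge0 ?powR_ge0// vC.
Qed.

(** With S = E^-1 P, one has S_y - S_x = E_y^-1 ((P_y - P_x) - (E_y - E_x) S_x);
    thus S inherits the exponent of D as long as E^-1 is bounded. *)
Lemma holder_invmx_mulmx {R : realType} {N n k : nat} (al W : R)
    (X : set 'cV[R]_N) (D : 'cV[R]_N -> 'M[R]_(n, k + n)) :
  0 <= W -> holder al X D ->
  (forall x, X x -> rsubmx (D x) \in unitmx) ->
  (forall x, X x -> `|invmx (rsubmx (D x))| <= W) ->
  holder al X (fun x => - (invmx (rsubmx (D x)) *m lsubmx (D x))).
Proof.
move=> W0 /holder_bounds[M [L [M0 L0 DM DL]]] uD WD.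
pose S x := invmx (rsubmx (D x)) *m lsubmx (D x).
have SM x : X x -> `|S x| <= n%:R * (W * M).
  move=> Xx; rewrite (le_trans (ler_norm_mulmx _ _))// ler_wpM2l//.
  by rewrite ler_pM// ?WD// (le_trans (ler_norm_lsubmx _))// DM.
pose C := n%:R * (W * (1 + n%:R * (n%:R * (W * M)))).
have C0 : 0 <= C by rewrite !(mulr_ge0, addr_ge0).
apply: (@holder_intro _ _ _ _ (n%:R * (W * M)) (C * L)).
  by move=> x Xx; rewrite normrN SM.
move=> x y Xx Xy; rewrite -opprD normrN -/(S x) -/(S y).
have ExS : rsubmx (D x) *m S x = lsubmx (D x) by rewrite mulKVmx// uD.
have -> : S y - S x = invmx (rsubmx (D y)) *m
    (lsubmx (D y - D x) - rsubmx (D y - D x) *m S x).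
  rewrite !linearB/= (mulmxBl (rsubmx (D y))) ExS mulmxBr.
  by rewrite mulKmx ?uD// opprB addrA subrK.
rewrite (le_trans (ler_norm_mulmx _ _))// /C -!mulrA ler_wpM2l//.
rewrite ler_pM// ?WD//.
have DL' := DL _ _ Xx Xy.
rewrite (le_trans (ler_normB _ _))// mulrDl mul1r lerD//.
  by rewrite (le_trans (ler_norm_lsubmx _)).
rewrite (le_trans (ler_norm_mulmx _ _))// -mulrA ler_wpM2l// mulrC ler_pM//.
  exact: SM.
by rewrite (le_trans (ler_norm_rsubmx _)).
Qed.

(** * Vertical and horizontal increments of f *)

Lemma cube_col_mx {R : realType} (I : set R) (m n : nat) (p : 'cV[R]_m)
    (a : 'cV[R]_n) :
  cube I (m + n) (col_mx p a) <-> cube I m p /\ cube I n a.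
Proof.
split=> [Ipa|[Ip Ia] i].
  split=> i; first by have := Ipa (lshift n i); rewrite col_mxEu.
  by have := Ipa (rshift m i); rewrite col_mxEd.
by rewrite mxE; case: (fintype.split i).
Qed.

Lemma cube_convex {R : realType} (I : set R) (n : nat) (x y : 'cV[R]_n)
    (t : R) :
  is_interval I -> cube I n x -> cube I n y -> 0 <= t <= 1 ->
  cube I n (x + t *: (y - x)).
Proof.
move=> itvI Ix Iy /andP[t0 t1] i; rewrite !mxE.
have [xy|yx] := leP (x i 0) (y i 0).
  by apply: (itvI (x i 0) (y i 0)) => //; nra.
by apply: (itvI (y i 0) (x i 0)) => //; nra.
Qed.

Lemma mulmx_adjoin_id_increment {R : realType} {m k n l : nat}
    (g : 'cV[R]_m -> 'cV[R]_k) (D : 'M[R]_(l, k + n)) (p q : 'cV[R]_m)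
    (a b : 'cV[R]_n) :
  D *m (adjoin_id g (col_mx q b) - adjoin_id g (col_mx p a)) =
  lsubmx D *m (g q - g p) + rsubmx D *m (b - a).
Proof.
rewrite /adjoin_id !col_mxKu !col_mxKd opp_col_mx add_col_mx.
by rewrite -[in LHS](hsubmxK D) mul_row_col.
Qed.

(** When only the second component moves, g does not contribute to the
    increment of [adjoin_id g], and f(p, .) has the differential A(p, .) in the
    ordinary sense; so the improved remainder estimate applies to it. *)
Lemma vertical_remainder {R : realType} (I : set R) (m n k : nat) (gamma L : R)
    (g : 'cV[R]_m -> 'cV[R]_k) (f : 'cV[R]_(m + n) -> 'cV[R]_n)
    (Df : 'cV[R]_(m + n) -> 'M[R]_(n, k + n)) :
  is_interval I -> 0 < gamma -> 0 <= L ->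
  is_derivative_wrt (cube I (m + n)) (adjoin_id g) f Df ->
  (forall x y, cube I (m + n) x -> cube I (m + n) y ->
     `|Df y - Df x| <= L * `|y - x| `^ gamma) ->
  forall p a b, cube I m p -> cube I n a -> cube I n b ->
    `|f (col_mx p b) - f (col_mx p a) - rsubmx (Df (col_mx p a)) *m (b - a)| <=
    n%:R * L * (`|b - a| `^ gamma * `|b - a|).
Proof.
move=> itvI gamma0 L0 [_ /unif_little_oP fo] DfL p a b Ip.
have sub_col a' b' :
    col_mx p b' - col_mx p a' = col_mx (0 : 'cV[R]_m) (b' - a').
  by rewrite opp_col_mx add_col_mx subrr.
have Ipa c : cube I n c -> cube I (m + n) (col_mx p c).
  by move=> Ic; apply/cube_col_mx.
apply: (@holder_remainder _ _ _ (cube I n) (fun c => f (col_mx p c))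
  (fun c => rsubmx (Df (col_mx p c)))) => //.
- by move=> x y t; exact: cube_convex.
- move=> x y Ix Iy; rewrite -linearB/= (le_trans (ler_norm_rsubmx _))//.
  by rewrite (le_trans (DfL _ _ (Ipa _ Ix) (Ipa _ Iy)))// sub_col norm_col_mx0l.
- apply/unif_little_oP => e e0; have [d d0 dP] := fo e e0.
  exists d => // x y Ix Iy xyd.
  have := dP _ _ (Ipa _ Ix) (Ipa _ Iy).
  rewrite sub_col norm_col_mx0l mulmx_adjoin_id_increment subrr mulmx0 add0r.
  exact.
Qed.

Lemma horizontal_remainder {R : realType} (I : set R) (m n k : nat)
    (g : 'cV[R]_m -> 'cV[R]_k) (f : 'cV[R]_(m + n) -> 'cV[R]_n)
    (Df : 'cV[R]_(m + n) -> 'M[R]_(n, k + n)) (e : R) :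
  is_derivative_wrt (cube I (m + n)) (adjoin_id g) f Df -> 0 < e ->
  exists2 d : R, 0 < d & forall p q a,
    cube I m p -> cube I m q -> cube I n a -> `|q - p| <= d ->
    `|f (col_mx q a) - f (col_mx p a) - lsubmx (Df (col_mx p a)) *m (g q - g p)|
    <= e * `|q - p|.
Proof.
move=> [_ /unif_little_oP fo] e0; have [d d0 dP] := fo e e0.
exists d => // p q a Ip Iq Ia pqd.
have := dP (col_mx p a) (col_mx q a).
rewrite mulmx_adjoin_id_increment opp_col_mx add_col_mx subrr mulmx0 addr0.
by rewrite norm_col_mx0r; apply => //; apply/cube_col_mx.
Qed.

(** Here the increment of g, of order |q - p|^beta, dominates the remainder,
    which is at most |q - p| <= |q - p|^beta for |q - p| <= 1. *)
Lemma horizontal_holder {R : realType} (I : set R) (m n k : nat)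
    (beta gamma : R)
    (g : 'cV[R]_m -> 'cV[R]_k) (f : 'cV[R]_(m + n) -> 'cV[R]_n)
    (Df : 'cV[R]_(m + n) -> 'M[R]_(n, k + n)) :
  0 < beta <= 1 ->
  holder beta (cube I m) g ->
  is_derivative_wrt (cube I (m + n)) (adjoin_id g) f Df ->
  holder gamma (cube I (m + n)) Df ->
  exists C d : R, [/\ 0 <= C, 0 < d & forall p q a,
    cube I m p -> cube I m q -> cube I n a -> `|q - p| <= d ->
    `|f (col_mx q a) - f (col_mx p a)| <= C * `|q - p| `^ beta].
Proof.
move=> /andP[beta0 beta1] /holder_bounds[_ [L [_ L0 _ gL]]] dfD.
move=> /holder_bounds[M [_ [M0 _ DM _]]].
have [d d0 dP] := horizontal_remainder dfD ltr01.
exists (k%:R * (M * L) + 1), (Num.min d 1); split.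
- by rewrite !(addr_ge0, mulr_ge0).
- by rewrite lt_min d0 ltr01.
move=> p q a Ip Iq Ia; rewrite le_min => /andP[pqd pq1].
rewrite -(subrK (lsubmx (Df (col_mx p a)) *m (g q - g p))
  (f (col_mx q a) - f (col_mx p a))).
rewrite (le_trans (ler_normD _ _))// addrC mulrDl lerD//.
  rewrite (le_trans (ler_norm_mulmx _ _))// -!mulrA ler_wpM2l// ler_pM//.
    by rewrite (le_trans (ler_norm_lsubmx _))// DM//; apply/cube_col_mx.
  exact: gL.
rewrite (le_trans (dP _ _ _ Ip Iq Ia pqd))// ler_wpM2l//.
have [->|pq0] := eqVneq `|q - p| 0; first exact: powR_ge0.
rewrite -[leLHS]powRr1// ger_powR// pq1 andbT lt_neqAle eq_sym pq0/=//.
Qed.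

(** The decomposition through the corner (q, a): u, v and w stand for f(q, b),
    f(q, a) and f(p, a), dth for b - a, dg for the increment of g, E and P for
    the two blocks of Df at (p, a), and A for the block that multiplies dth at
    the corner.  The points (p, a) and (q, b) lie on a level set, so u = w. *)
Lemma implicit_increment {R : realType} {m k n : nat} (E : 'M[R]_n)
    (P : 'M[R]_(n, k)) (A : 'M[R]_n) (dg : 'cV[R]_k) (dth u v w : 'cV[R]_n) :
  E \in unitmx -> u = w ->
  dth - - (invmx E *m P) *m dg = - (invmx E *m
    ((u - v - A *m dth) + (A - E) *m dth + (v - w - P *m dg))).
Proof.
move=> uE ->.
have -> : w - v - A *m dth + (A - E) *m dth + (v - w - P *m dg) =
    - (E *m dth + P *m dg).
  rewrite mulmxBl; move: (A *m _) (E *m _) (P *m _) => x y z.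
  by apply/matrixP => i j; rewrite !mxE; ring.
by rewrite mulmxN opprK mulmxDr mulKmx// mulNmx opprK mulmxA.
Qed.

(** * The implicit function *)

Lemma parametrizes_unique {R : realType} {m n : nat} (I : set R)
    (f : 'cV[R]_(m + n) -> 'cV[R]_n) (x0 : 'cV[R]_(m + n))
    (Jm : set 'cV[R]_m) (Jn : set 'cV[R]_n)
    (theta theta' : 'cV[R]_m -> 'cV[R]_n) :
  parametrizes I f x0 Jm Jn theta -> parametrizes I f x0 Jm Jn theta' ->
  forall p, Jm p -> theta' p = theta p.
Proof.
move=> [_ thE] [_ th'E] p Jp.
have : (graph_map theta' @` Jm) (graph_map theta' p) by exists p.
by rewrite -th'E thE => -[q Jq /eq_col_mx[<-]].
Qed.

(** Uniformly in the first component, B f(p, .) is a 1/2-perturbation of the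
    identity, up to a constant.  One quarter comes from replacing A by A(x0), the other from the
    vertical remainder; both are bounded by the same constant C times a
    distance to the power gamma. *)
Lemma vertical_inverse_near {R : realType} (I : set R) (m n k : nat)
    (gamma : R) (g : 'cV[R]_m -> 'cV[R]_k) (f : 'cV[R]_(m + n) -> 'cV[R]_n)
    (Df : 'cV[R]_(m + n) -> 'M[R]_(n, k + n)) (x0 : 'cV[R]_(m + n)) :
  is_interval I -> 0 < gamma ->
  is_derivative_wrt (cube I (m + n)) (adjoin_id g) f Df ->
  holder gamma (cube I (m + n)) Df ->
  (cube I (m + n))° x0 -> rsubmx (Df x0) \in unitmx ->
  let B := invmx (rsubmx (Df x0)) in
  exists2 r : R, 0 < r & forall x, `|x - x0| <= r ->
    [/\ cube I (m + n) x,
        rsubmx (Df x) \in unitmx /\ `|invmx (rsubmx (Df x))| <= 2 * `|B| &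
        forall b, `|col_mx (usubmx x) b - x0| <= r ->
          `|B *m (f (col_mx (usubmx x) b) - f x) - (b - dsubmx x)| <=
          2^-1 * `|b - dsubmx x|].
Proof.
move=> itvI gamma0 dfD /holder_bounds[_ [L [_ L0 _ DL]]] intx0 uA B.
have [r0 /= r00 Xr0] : exists2 r0 : R, 0 < r0 &
    forall x, `|x - x0| < r0 -> cube I (m + n) x.
  have /nbhs_normP[r0 r00 Xr0] := intx0.
  by exists r0 => // x xx0; apply: Xr0; rewrite /= distrC.
have Xx0 : cube I (m + n) x0 by apply: Xr0; rewrite subrr normr0.
pose C := n%:R * (`|B| * (n%:R * L)).
have e0 : 0 < 4^-1 :> R by rewrite invr_gt0.
have [d d0 dC] := powR_near0 C gamma0 e0.
pose r := Num.min (r0 / 2) (d / 2).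
have rr0 : r < r0 by rewrite gt_min; apply/orP; left; lra.
have rd : 2 * r <= d.
  by have : r <= d / 2 by [rewrite /r ge_min lexx orbT]; lra.
have r_gt0 : 0 < r by rewrite lt_min !divr_gt0.
have Xr x : `|x - x0| <= r -> cube I (m + n) x.
  by move=> xr; apply: Xr0; exact: le_lt_trans rr0.
have BV x j (V : 'M[R]_(n, j)) : `|x - x0| <= r ->
    `|B *m (rsubmx (Df x) *m V) - V| <= 4^-1 * `|V|.
  move=> xr; rewrite (le_trans (perturbed_left_inverse _ _ uA))//.
  rewrite (@le_trans _ _ (C * `|x - x0| `^ gamma * `|V|))//.
    rewrite /C -!mulrA ler_wpM2l// ler_wpM2l// ler_wpM2l// mulrA ler_wpM2r//.
    rewrite -linearB/= (le_trans (ler_norm_rsubmx _))//.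
    by apply: DL => //; exact: Xr.
  rewrite ler_wpM2r// dC// normr_ge0/=; lra.
exists r => // x xr; split; first exact: Xr.
- apply: approx_left_inverse_unitmx => V; rewrite (le_trans (BV _ _ _ xr))//.
  by rewrite ler_wpM2r//; lra.
- move: xr; rewrite -(vsubmxK x) !col_mxKu !col_mxKd.
  move: (usubmx x) (dsubmx x) => p a ar b br.
  have [Ip Ia] := (cube_col_mx _ _ _).1 (Xr _ ar).
  have [_ Ib] := (cube_col_mx _ _ _).1 (Xr _ br).
  have ba : `|b - a| <= d.
    have := ler_distD x0 (col_mx p b) (col_mx p a).
    rewrite (distrC x0) opp_col_mx add_col_mx subrr norm_col_mx0l; lra.
  set E := rsubmx (Df (col_mx p a)).
  set df := f (col_mx p b) - _.
  have -> : B *m df - (b - a) =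
      B *m (df - E *m (b - a)) + (B *m (E *m (b - a)) - (b - a)).
    by rewrite (mulmxBr B df) subrKA.
  rewrite (le_trans (ler_normD _ _))//.
  have := BV _ _ (b - a) ar; rewrite -/E.
  suff : `|B *m (df - E *m (b - a))| <= 4^-1 * `|b - a| by lra.
  rewrite (le_trans (ler_norm_mulmx _ _))//.
  rewrite (@le_trans _ _ (C * `|b - a| `^ gamma * `|b - a|))//; last first.
    by rewrite ler_wpM2r// dC// normr_ge0.
  rewrite /C -!mulrA ler_wpM2l// ler_wpM2l// !mulrA -mulrA.
  exact: (vertical_remainder itvI gamma0 L0 dfD DL).
Qed.

(** This is where beta (1 + gamma) > 1 enters.  The vertical remainder and the
    displacement of A are each O(|q - p|^(beta (1 + gamma))), that is |q - p|
    times a power of |q - p| with positive exponent, and the horizontal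
    remainder is o(|q - p|) whatever the exponents. *)
Lemma implicit_remainder {R : realType} (I : set R) (m n k : nat)
    (beta gamma H W : R)
    (g : 'cV[R]_m -> 'cV[R]_k) (f : 'cV[R]_(m + n) -> 'cV[R]_n)
    (Df : 'cV[R]_(m + n) -> 'M[R]_(n, k + n))
    (J : set 'cV[R]_m) (theta : 'cV[R]_m -> 'cV[R]_n) :
  is_interval I -> 0 < beta <= 1 -> 0 < gamma <= 1 -> beta * (1 + gamma) > 1 ->
  is_derivative_wrt (cube I (m + n)) (adjoin_id g) f Df ->
  holder gamma (cube I (m + n)) Df ->
  J `<=` cube I m -> (forall p, J p -> cube I n (theta p)) ->
  0 <= H -> 0 <= W ->
  (forall p q, J p -> J q ->
     f (graph_map theta p) = f (graph_map theta q)) ->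
  (forall p, J p -> rsubmx (Df (graph_map theta p)) \in unitmx /\
     `|invmx (rsubmx (Df (graph_map theta p)))| <= W) ->
  (forall p q, J p -> J q ->
     `|theta q - theta p| <= H * `|q - p| `^ beta) ->
  unif_little_o J (fun p q => theta q - theta p -
    - (invmx (rsubmx (Df (graph_map theta p))) *m
       lsubmx (Df (graph_map theta p))) *m (g q - g p)).
Proof.
move=> itvI /andP[beta0 beta1] /andP[gamma0 gamma1] bg dfD.
move=> /holder_bounds[_ [L [_ L0 _ DL]]] JI thI H0 W0 fth uW thH.
have VR := vertical_remainder itvI gamma0 L0 dfD DL.
have kappa0 : 0 < beta * (1 + gamma) - 1 by rewrite subr_gt0.
apply/unif_little_oP => e e0.
pose nW := n%:R * W + 1.
have nW0 : 0 < nW by rewrite ltr_wpDl// mulr_ge0.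
have e'0 : 0 < e / nW / 2 by rewrite !divr_gt0.
pose C := n%:R * L * (H `^ gamma * H) + n%:R * L * H.
have [d1 d10 d1P] := horizontal_remainder dfD e'0.
have [d2 d20 d2P] := powR_near0 C kappa0 e'0.
exists (Num.min 1 (Num.min d1 d2)); first by rewrite !lt_min ltr01 d10.
move=> p q Jp Jq; rewrite !le_min => /and3P[].
set t := `|q - p| => t1 td1 td2.
have t0 : 0 <= t by exact: normr_ge0.
have [Ip Iq] := (JI _ Jp, JI _ Jq).
have [Ia Ib] := (thI _ Jp, thI _ Jq).
have [uE EW] := uW _ Jp.
rewrite (@implicit_increment _ _ _ _ _ _ (rsubmx (Df (col_mx q (theta p)))) _ _
  (f (graph_map theta q)) (f (col_mx q (theta p))) (f (graph_map theta p)))//;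
  last exact: fth.
have Hab : `|theta q - theta p| <= H * t `^ beta by exact: thH.
have kE : beta * gamma + beta = beta * (1 + gamma) - 1 + 1 by ring.
have k0 : beta * gamma + beta != 0 by rewrite gt_eqF// kE addr_gt0.
have tpow : t `^ (beta * gamma) * t `^ beta = t `^ (beta * (1 + gamma) - 1) * t.
  rewrite -[X in _ = _ * X](powRr1 t0) -!powRD -?kE ?(negbTE k0)//.
have Hg : `|theta q - theta p| `^ gamma <= H `^ gamma * t `^ (beta * gamma).
  rewrite powRrM -powRM ?powR_ge0//.
  by apply: ge0_ler_powR; rewrite ?nnegrE ?mulr_ge0 ?powR_ge0// ltW.
(* As t <= 1, the larger exponent gamma may be lowered to beta * gamma. *)
have tg : t `^ gamma <= t `^ (beta * gamma).
  have [->|tn0] := eqVneq t 0.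
    by rewrite !powR0 ?mulf_neq0 ?gt_eqF.
  apply: ger_powR; first by rewrite t1 lt_neqAle eq_sym tn0 t0.
  by rewrite ler_piMl// ltW.
(* The vertical remainder, from the corner (q, theta p) to (q, theta q). *)
have T1 : `|f (graph_map theta q) - f (col_mx q (theta p)) -
    rsubmx (Df (col_mx q (theta p))) *m (theta q - theta p)| <=
    n%:R * L * (H `^ gamma * H) * t `^ (beta * (1 + gamma) - 1) * t.
  rewrite (le_trans (VR _ _ _ Iq Ia Ib))// -[leRHS]mulrA -tpow -[leRHS]mulrA.
  by rewrite ler_wpM2l ?mulr_ge0// mulrACA ler_pM ?powR_ge0.
(* The cost of moving A from (p, theta p) to the corner. *)
have T2 : `|(rsubmx (Df (col_mx q (theta p))) - rsubmx (Df (graph_map theta p)))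
      *m (theta q - theta p)| <=
    n%:R * L * H * t `^ (beta * (1 + gamma) - 1) * t.
  rewrite (le_trans (ler_norm_mulmx _ _))// -[leRHS]mulrA -tpow.
  rewrite (@le_trans _ _ (n%:R * ((L * t `^ (beta * gamma)) * (H * t `^ beta))))//.
    rewrite ler_wpM2l// ler_pM// -linearB/= (le_trans (ler_norm_rsubmx _))//.
    have X1 : cube I (m + n) (graph_map theta p) by apply/cube_col_mx.
    have X2 : cube I (m + n) (col_mx q (theta p)) by apply/cube_col_mx.
    rewrite (le_trans (DL _ _ X1 X2))// ler_wpM2l//.
    by rewrite opp_col_mx add_col_mx subrr norm_col_mx0r.
  by rewrite le_eqVlt; apply/orP; left; apply/eqP; ring.
have T3 := d1P _ _ _ Ip Iq Ia td1.
rewrite normrN (le_trans (ler_norm_mulmx _ _))//.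
set S := `|_ + _ + _|.
have SC : S <= C * t `^ (beta * (1 + gamma) - 1) * t + e / nW / 2 * t.
  rewrite /S (le_trans (ler_normD _ _))// lerD//.
  by rewrite (le_trans (ler_normD _ _))// /C mulrDl mulrDl lerD.
have Se : S <= e / nW * t.
  rewrite (le_trans SC)// [X in _ <= X * _](splitr (e / nW)) [leRHS]mulrDl lerD2r.
  by rewrite ler_wpM2r// d2P// t0.
rewrite (@le_trans _ _ (nW * S))//.
  by rewrite mulrA ler_wpM2r ?normr_ge0// /nW (le_trans (ler_wpM2l _ EW))// lerDl.
rewrite (le_trans (ler_wpM2l (ltW nW0) Se))// mulrA mulrCA mulfV ?gt_eqF//.
by rewrite mulr1.
Qed.

Theorem theorem3p1 (R : realType) (I : set R) (m n k : nat) (beta gamma : R)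
    (g : 'cV[R]_m -> 'cV[R]_k)
    (f : 'cV[R]_(m + n) -> 'cV[R]_n)
    (Df : 'cV[R]_(m + n) -> 'M[R]_(n, k + n))
    (x0 : 'cV[R]_(m + n)) :
  is_interval I -> bounded_set I ->
  (1 <= m)%N -> (1 <= n)%N -> (1 <= k)%N ->
  0 < beta <= 1 -> 0 < gamma <= 1 -> beta * (1 + gamma) > 1 ->
  holder beta (cube I m) g ->
  is_derivative_wrt (cube I (m + n)) (adjoin_id g) f Df ->
  holder gamma (cube I (m + n)) Df ->
  (cube I (m + n))° x0 ->
  rsubmx (Df x0) \in unitmx ->
  exists (Jm : set 'cV[R]_m) (Jn : set 'cV[R]_n),
    [/\ open Jm, open Jn, Jm `<=` cube I m, Jn `<=` cube I n &
        prod_set Jm Jn x0] /\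
    prod_set Jm Jn `<=` cube I (m + n) /\
    exists theta : 'cV[R]_m -> 'cV[R]_n,
      let Dtheta p := - (invmx (rsubmx (Df (graph_map theta p)))
                           *m lsubmx (Df (graph_map theta p))) in
      [/\ parametrizes I f x0 Jm Jn theta,
          (forall theta', parametrizes I f x0 Jm Jn theta' ->
             forall p, Jm p -> theta' p = theta p),
          (forall p, Jm p -> rsubmx (Df (graph_map theta p)) \in unitmx),
          is_derivative_wrt Jm g theta Dtheta &
          holder (beta * gamma) Jm Dtheta].
Proof.
move=> itvI _ _ _ _ beta01 gamma01 bg gH dfD DfH intx0 uA.
have /andP[beta0 beta1] := beta01; have /andP[gamma0 gamma1] := gamma01.
have [r r0 /= rP] := vertical_inverse_near itvI gamma0 dfD DfH intx0 uA.
move: rP; set B := invmx _ => rP.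
have uB : B \in unitmx by rewrite unitmx_inv.
have [C [d [C0 d0 hC]]] := horizontal_holder beta01 gH dfD DfH.
pose p0 := usubmx x0; pose a0 := dsubmx x0.
have x0E : x0 = col_mx p0 a0 by rewrite vsubmxK.
have nearE p a (e : R) : `|p - p0| <= e -> `|a - a0| <= e ->
    `|col_mx p a - x0| <= e.
  by move=> pe ae; rewrite x0E opp_col_mx add_col_mx norm_col_mx ge_max pe.
have r4 : 0 < r / 4 by rewrite divr_gt0.
have [d' d'0 d'P] := powR_near0 (n%:R * (`|B| * C)) beta0 r4.
(* rho <= d' brings the starting point a0 of Newton's iteration within r / 4
   of solving f(p, .) = f(x0), after multiplication by B; the bounds on 2 rho
   make any two points of Jm close enough for the horizontal estimate, and at
   most 1 apart. *)
pose rho := Num.min (Num.min r d') (Num.min (d / 2) (1 / 2)).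
have rho0 : 0 < rho by rewrite !lt_min r0 d'0 !divr_gt0.
have [rho_r rho_d' rho_d rho_1] :
    [/\ rho <= r, rho <= d', 2 * rho <= d & 2 * rho <= 1].
  have : rho <= rho by [].
  rewrite {2}/rho !le_min => /andP[/andP[-> ->] /andP[h1 h2]]; split=> //; lra.
pose Jm := ball p0 rho; pose Jn := ball a0 r.
have JmE p : Jm p -> `|p - p0| < rho.
  by rewrite /Jm -ball_normE /ball_ /= distrC.
have JnE a : Jn a <-> `|a - a0| < r.
  by rewrite /Jn -ball_normE /ball_ /= distrC.
have Jr p a : Jm p -> Jn a -> `|col_mx p a - x0| <= r.
  move=> /JmE pp0 /JnE /ltW aa0; apply: nearE => //.
  by rewrite (le_trans (ltW pp0)).
have Jp0 : Jm p0 by exact: ballxx.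
have Ja0 : Jn a0 by exact: ballxx.
have JI p a : Jm p -> Jn a -> cube I m p /\ cube I n a.
  by move=> Jp Ja; apply/cube_col_mx; have [] := rP _ (Jr _ _ Jp Ja).
have diam p q : Jm p -> Jm q -> `|q - p| <= d /\ `|q - p| <= 1.
  move=> /JmE Jp /JmE Jq.
  have := ler_distD p0 q p; rewrite (distrC p0) => ?; split; lra.
have rB p a b : Jm p -> Jn a -> Jn b ->
    `|B *m (f (col_mx p b) - f (col_mx p a)) - (b - a)| <= 2^-1 * `|b - a|.
  move=> Jp Ja Jb; have [_ _] := rP _ (Jr _ _ Jp Ja).
  by move=> /(_ b); rewrite col_mxKu col_mxKd; apply; exact: Jr.
have rB2 p a b : Jm p -> Jn a -> Jn b ->
    `|b - a| <= 2 * `|B *m (f (col_mx p b) - f (col_mx p a))|.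
  move=> Jp Ja Jb; have := rB _ _ _ Jp Ja Jb; set u := _ *m _.
  have := ler_distD u (b - a) 0; rewrite !subr0 distrC; lra.
have r2r a : `|a - a0| <= r / 2 -> Jn a by move=> aa0; apply/JnE; lra.
(* The iteration runs in the closed ball of radius r / 2, which lies in Jn. *)
have ex_th p : Jm p -> exists a, Jn a /\ f (col_mx p a) = f x0.
  move=> Jp.
  have r2 : 0 < r / 2 by rewrite divr_gt0.
  have [a b /r2r Ja /r2r Jb||a /r2r Ja Ba0] :=
      @newton_zero _ _ (fun a => f (col_mx p a)) B a0 (f x0) (r / 2) r2; first exact: rB.
    have [Ip Ia0] := JI _ _ Jp Ja0; have [Ip0 _] := JI _ _ Jp0 Ja0.
    rewrite (le_trans (ler_norm_mulmx _ _))//.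
    rewrite (@le_trans _ _ (n%:R * (`|B| * C) * `|p - p0| `^ beta))//.
      rewrite -!mulrA ler_wpM2l// ler_wpM2l// [in f x0]x0E hC//.
      by have [] := diam _ _ Jp0 Jp.
    rewrite (le_trans (d'P _ _))//; last lra.
    by rewrite normr_ge0/= (le_trans (ltW (JmE _ Jp))).
  exists a; split => //; apply/eqP.
  by rewrite -subr_eq0 -[X in X == 0](mulKmx uB) Ba0 mulmx0.
pose theta p : 'cV[R]_n := xget 0 [set a | Jn a /\ f (col_mx p a) = f x0].
have thP p : Jm p -> Jn (theta p) /\ f (graph_map theta p) = f x0.
  by move=> /ex_th; exact: xgetPex.
have thJ p : Jm p -> Jn (theta p) by move=> /thP[].
have Jx0 : prod_set Jm Jn `<=` cube I (m + n).
  move=> x [Jp Ja]; rewrite -(vsubmxK x).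
  by apply/cube_col_mx; exact: JI.
have param : parametrizes I f x0 Jm Jn theta.
  split=> [p Jp|]; first by have [] := JI _ _ Jp (thJ _ Jp).
  apply/seteqP; split => [x [/= fx [Jp Ja]]|_ [p Jp <-]]; last first.
    have [Jt ft] := thP _ Jp.
    by split => //; split; rewrite /graph_map ?col_mxKu ?col_mxKd.
  exists (usubmx x) => //; rewrite /graph_map -[RHS]vsubmxK; congr col_mx.
  have [Jt ft] := thP _ Jp.
  apply/eqP; rewrite -subr_eq0 -normr_le0 (le_trans (rB2 _ _ _ Jp Ja Jt))//.
  by rewrite vsubmxK fx [f _]ft subrr mulmx0 normr0 mulr0.
have uW p : Jm p -> rsubmx (Df (graph_map theta p)) \in unitmx /\
    `|invmx (rsubmx (Df (graph_map theta p)))| <= 2 * `|B|.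
  by move=> Jp; have [_ ? _] := rP _ (Jr _ _ Jp (thJ _ Jp)).
(* Along the level set a vertical increment of f is the opposite of a
   horizontal one, which is beta-Hölder. *)
pose H := 2 * (n%:R * (`|B| * C)).
have H0 : 0 <= H by rewrite !mulr_ge0.
have thH p q : Jm p -> Jm q -> `|theta q - theta p| <= H * `|q - p| `^ beta.
  move=> Jp Jq; have [Jt ft] := thP _ Jp; have [Ju fu] := thP _ Jq.
  rewrite (le_trans (rB2 _ _ _ Jq Jt Ju))// -mulrA ler_wpM2l//.
  rewrite (le_trans (ler_norm_mulmx _ _))// -!mulrA ler_wpM2l// ler_wpM2l//.
  rewrite [f (col_mx q (theta q))]fu -ft distrC hC//.
  - by have [] := JI _ _ Jp Jt.
  - by have [] := JI _ _ Jq Jt.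
  - by have [] := JI _ _ Jp Jt.
  - by have [] := diam _ _ Jp Jq.
have DfthH : holder (beta * gamma) Jm (Df \o graph_map theta).
  apply: (@holder_comp _ _ _ _ gamma beta (1 + H) _ (cube I (m + n))) => //.
  - exact: ltW.
  - by rewrite addr_ge0.
  - by move=> p Jp; apply/cube_col_mx; apply: JI => //; exact: thJ.
  move=> p q Jp Jq; have [_ pq1] := diam _ _ Jp Jq.
  rewrite opp_col_mx add_col_mx norm_col_mx mulrDl mul1r ge_max.
  apply/andP; split.
    (* |q - p| <= |q - p|^beta, as |q - p| <= 1. *)
    have [->|pq0] := eqVneq `|q - p| 0; first by rewrite addr_ge0 ?mulr_ge0 ?powR_ge0.
    rewrite ler_wpDr ?mulr_ge0 ?powR_ge0// -[leLHS]powRr1//.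
    by apply: ger_powR => //; rewrite pq1 lt_neqAle eq_sym pq0/= normr_ge0.
  by rewrite (le_trans (thH _ _ Jp Jq))// lerDr powR_ge0.
have DthH := holder_invmx_mulmx (mulr_ge0 (ler0n _ 2) (normr_ge0 B)) DfthH
  (fun p Jp => (uW p Jp).1) (fun p Jp => (uW p Jp).2).
exists Jm, Jn; split; last split => //.
  split; rewrite ?/Jm ?/Jn; try exact: ball_open.
  - by move=> p Jp; have [] := JI _ _ Jp Ja0.
  - by move=> a Ja; have [] := JI _ _ Jp0 Ja.
  - by split.
exists theta; split => //.
- by move=> theta'; exact: parametrizes_unique.
- by move=> p /uW[].
- split; first exact: holder_within_continuous (mulr_gt0 beta0 gamma0) DthH.
  apply: (implicit_remainder itvI beta01 gamma01 bg dfD DfH _ _ H0 _ _ uW thH).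
  + by move=> p Jp; have [] := JI _ _ Jp Ja0.
  + by move=> p Jp; have [] := JI _ _ Jp (thJ _ Jp).
  + by rewrite mulr_ge0.
  + by move=> p q /thP[_ ->] /thP[_ ->].
Qed.
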